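(* If a topological space $X$ has an irreducible base, then $w(X)=\chi(X)\cdot|X|$.
   Context: $w$ and $\chi$ denote weight and character; as usual, cardinal functions take only infinite values. A base $\mathcal U$ (of open sets) of a space $X$ is irreducible if it can be written $\mathcal U=\bigcup\{\mathcal U_x:x\in X\}$ where (1) $\mathcal U_x$ is a neighbourhood base of $x$ in $X$ for each $x\in X$; and (2) for each $x\in X$ the family $\bigcup_{y\ne x}\mathcal U_y$ is not a base of $X$. *)

(* Defs.v *)
From HB Require Import structures.
From mathcomp Require Import all_boot all_order all_algebra.
From mathcomp Require Import boolp classical_sets functions cardinality filter.
From mathcomp Require Import topology_structure.

Set Implicit Arguments.
Unset Strict Implicit.
Unset Printing Implicit Defensive.

Local Open Scope classical_set_scope.
Local Open Scope card_scope.

(** Cardinals are compared with the relations [#<=] and [#=].  A cardinal is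
    represented by a set of that cardinality; thus [A `*` B] represents the
    product of the cardinals represented by [A] and [B]. *)

(** A member of [F] of least cardinality ([set0] if [F] is empty). *)
Definition card_min (T : Type) (F : set (set T)) : set T :=
  xget set0 [set A | F A /\ forall B, F B -> A #<= B].

(** The supremum of the cardinals of the [F i].  Minimizing only over the upper
    bounds that are subsets of [T] loses nothing, see [card_sup_least]. *)
Definition card_sup (T I : Type) (F : I -> set T) : set T :=
  card_min [set A | forall i, F i #<= A].

(** Represents [|A| + omega], the maximum of [|A|] and [omega]: cardinal
    functions, [X |-> |X|] included, take only infinite values. *)
Definition card_infinite (T : Type) (A : set T) : set (T + nat) :=
  inl @` A `|` range inr.

Section cardinal_operations.

Let rel_card_le (T U : Type) (A : set T) (B : set U) (R : T -> U -> Prop) :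
  (forall a, A a -> exists2 b, B b & R a b) ->
  (forall a a' b, A a -> A a' -> R a b -> R a' b -> a = a') -> A #<= B.
Proof.
move=> totR injR; have totR' (a : A) : {b : B | R (val a) (val b)}.
  apply: cid; have [b Bb Rab] := totR _ (set_mem (valP a)).
  by exists (SigSub (mem_set Bb)).
pose f a := sval (totR' a).
apply/card_leP/injfunPex; exists f => // a a' _ _ faa'; apply/val_inj.
apply: (injR _ _ (val (f a))); [exact/set_mem/valP|exact/set_mem/valP| |].
- exact: (svalP (totR' a)).
- by rewrite faa'; exact: (svalP (totR' a')).
Qed.

Let card_least_ex (T : Type) (F : set (set T)) : F !=set0 ->
  exists A, F A /\ forall B, F B -> A #<= B.
Proof.
move=> [A0 FA0].
have [A00|/set0P[t0 At0]] := eqVneq A0 set0.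
  by exists A0; split=> // B _; rewrite A00.
pose P := [set E : set (set T -> T) |
  (forall h A, E h -> F A -> A (h A)) /\
  (forall h k A, E h -> E k -> F A -> h A = k A -> h = k)].
have [|E [[EF Einj] Emax]] := @Zorn_bigcup _ P.
  move=> G GP Gtot; split=> [h A [E GE Eh]|h k A [E GE Eh] [E' GE' E'k]].
    exact: (GP _ GE).1.
  have [EE'|E'E] := Gtot _ _ GE GE'.
  - by have [_] := GP _ GE'; apply=> //; exact: EE'.
  - by have [_] := GP _ GE; apply=> //; exact: E'E.
have [[A [FA EA]]|noA] := pselect (exists A, F A /\
    forall a, A a -> exists2 h, E h & h A = a).
  exists A; split=> // B FB.
  apply: (@rel_card_le _ _ _ _
    (fun a b => exists h, [/\ E h, h A = a & h B = b])).
    move=> a /EA[h Eh <-]; exists (h B); first exact: (EF h B).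
    by exists h.
  move=> a a' b _ _ [h [Eh <- hb]] [k [Ek <- kb]].
  by rewrite (Einj h k B)// hb kb.
exfalso.
have new A : exists a, F A -> A a /\ forall h, E h -> h A <> a.
  have [FA|nFA] := pselect (F A); last by exists t0.
  apply: contrapT => /forallNP nA; apply: noA; exists A; split=> // a Aa.
  apply: contrapT => na; apply: (nA a) => _; split=> // h Eh ha.
  by apply: na; exists h.
have [h0 h0P] := choice new.
apply: (Emax (E `|` [set h0])).
  split; first by left.
  move=> /(_ h0 (or_intror erefl)) Eh0.
  by have [_ /(_ _ Eh0)] := h0P _ FA0.
split=> [h A [Eh|->] FA|h k A [Eh|->] [Ek|->] FA hk].
- exact: (EF h A).
- by have [] := h0P _ FA.
- exact: (Einj _ _ A).
- by have [_ /(_ _ Eh)] := h0P _ FA.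
- by have [_ /(_ _ Ek)] := h0P _ FA; rewrite hk.
- by [].
Qed.

Lemma card_minP (T : Type) (F : set (set T)) : F !=set0 ->
  F (card_min F) /\ forall B, F B -> card_min F #<= B.
Proof. by move=> /card_least_ex /(xgetPex set0). Qed.

Lemma card_sup_ub (T I : Type) (F : I -> set T) i : F i #<= card_sup F.
Proof.
have [|H _] := @card_minP T [set A | forall i, F i #<= A]; last exact: H.
by exists setT => j /=; exact: card_leT.
Qed.

Lemma card_sup_least (T I U : Type) (F : I -> set T) (B : set U) :
  (forall i, F i #<= B) -> card_sup F #<= B.
Proof.
move=> FB; pose iB : set (T + U) := inr @` B; pose iT : set (T + U) := range inl.
have iBB : iB #= B by apply: inj_card_eq => ? ? _ _ [].
have iTT : iT #= [set: T] by apply: inj_card_eq => ? ? _ _ [].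
have supP : forall A : set T, (forall i, F i #<= A) -> card_sup F #<= A.
  have [|_ H] := @card_minP T [set A | forall i, F i #<= A]; last exact: H.
  by exists setT => j /=; exact: card_leT.
have [|C [CE Cmin]] := @card_least_ex _ [set iB; iT]; first by exists iB; left.
have {CE Cmin} [BT|TB] : B #<= [set: T] \/ [set: T] #<= B.
  case: CE Cmin => -> Cmin; [left|right].
    by rewrite -(card_le_eql iBB) -(card_le_eqr iTT); apply: Cmin; right.
  by rewrite -(card_le_eql iTT) -(card_le_eqr iBB); apply: Cmin; left.
- have [A AB] : exists A : set T, A #= B.
    have [f] := card_leP BT.
    exists (range (fun b => val (f b))); apply: card_eq_trans (card_setT B).
    by apply: inj_card_eq => b b' _ _ /val_inj; apply: inj; exact: in_setT.
  rewrite -(card_le_eqr AB); apply: supP => i.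
  by rewrite (card_le_eqr AB).
- exact: card_le_trans (card_leT _) TB.
Qed.

End cardinal_operations.

Section cardinal_functions.
Variable X : topologicalType.

Definition nbhd_base (x : X) (V : set (set X)) :=
  V `<=` nbhs x /\ forall A, nbhs x A -> exists2 B, V B & B `<=` A.

Definition irreducible_base (U : set (set X)) :=
  basis U /\ exists V : X -> set (set X),
    [/\ U = \bigcup_x V x,
        forall x, nbhd_base x (V x) &
        forall x, ~ basis (\bigcup_(y in [set~ x]) V y)].

Definition weight : set (set X + nat) :=
  card_infinite (card_min [set U : set (set X) | basis U]).

Definition character_at (x : X) : set (set X) := card_min (nbhd_base x).

Definition character : set (set X + nat) := card_infinite (card_sup character_at).

End cardinal_functions.

Arguments weight : clear implicits.
Arguments character : clear implicits.

(* Main.v *)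
(** The bound [w <= chi * |X|] holds in every space: collect the interiors of the
    members of minimal neighbourhood bases.  Conversely [chi <= w] always, and
    irreducibility yields [|X| <= w * w = w]: the failure of the base without
    [V x] gives a neighbourhood [O x] of [x] such that no member of [V y] with
    [y <> x] contains [x] and lies in [O x].  Given a base [W], choose
    [x \in W2 `<=` G `<=` W1 `<=` O x] with [W1], [W2] in [W] and [G] in [V x];
    then [x |-> (W1, W2)] is injective. *)
Require Import Defs.
From mathcomp Require Import all_boot all_order all_algebra.
From mathcomp Require Import boolp classical_sets functions cardinality filter.
From mathcomp Require Import topology_structure.

Local Open Scope classical_set_scope.
Local Open Scope card_scope.

Set Implicit Arguments.
Unset Strict Implicit.
Unset Printing Implicit Defensive.

(** * Embeddings as total functions, and comparability of cardinals *)

Lemma card_le_fun (T U : Type) (A : set T) (B : set U) (f : T -> U) :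
  (forall x, A x -> B (f x)) ->
  (forall x y, A x -> A y -> f x = f y -> x = y) -> A #<= B.
Proof.
move=> fAB finj.
have [g] : $|{injfun A >-> B}|.
  apply/injfunPex; exists f => // x y /set_mem Ax /set_mem Ay; exact: finj.
exact: inj_card_le g.
Qed.

(** Replaces the embedding between subtypes by a function on all of [T], with [u0] as default value
    outside [A]. *)
Lemma card_le_funP (T U : Type) (A : set T) (B : set U) (u0 : U) :
  A #<= B -> exists f : T -> U, (forall x, A x -> B (f x)) /\
    (forall x y, A x -> A y -> f x = f y -> x = y).
Proof.
move=> /card_leP[g].
have gex x : exists u, forall Ax : A x, u = val (g (SigSub (mem_set Ax))).
  have [Ax|nAx] := pselect (A x); last by exists u0.
  by exists (val (g (SigSub (mem_set Ax)))) => Ax'; rewrite (Prop_irrelevance Ax Ax').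
have [f fE] := choice gex; exists f; split=> [x Ax|x y Ax Ay].
  by rewrite (fE x Ax); exact/set_mem/valP.
rewrite (fE x Ax) (fE y Ay) => /val_inj gxy.
have /(congr1 val) := @inj _ _ _ g _ _ (in_setT _) (in_setT _) gxy.
by [].
Qed.

(** Comparability comes from the existence of least cardinals, applied to the pair of [A] and
    [B]. *)
Lemma card_le_total (T : Type) (A B : set T) : A #<= B \/ B #<= A.
Proof.
have [|mAB mle] := @card_minP T [set A; B]; first by exists A; left.
by case: mAB mle => -> mle; [left; apply: mle; right|right; apply: mle; left].
Qed.

(** * The square of an infinite cardinal *)

Definition square_inj (T : Type) (A : set T) (f : T -> T -> T) :=
  (forall x y, A x -> A y -> A (f x y)) /\
  (forall x y x' y', A x -> A y -> A x' -> A y' ->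
    f x y = f x' y' -> x = x' /\ y = y').

Definition agree_on_square (T : Type) (A : set T) (f g : T -> T -> T) :=
  forall x y, A x -> A y -> f x y = g x y.

(** Zorn's lemma on pairs of a set and an injection, ordered by extension. Since the functions are
    total, two pairs may extend each other and still differ off the square, so this is only a
    preorder. *)
Lemma square_inj_maximal (T : Type) (S A0 : set T) (f0 : T -> T -> T) :
  A0 `<=` S -> square_inj A0 f0 ->
  exists A f, [/\ A0 `<=` A, A `<=` S, square_inj A f &
    forall A' f', A' `<=` S -> square_inj A' f' -> A `<=` A' ->
      agree_on_square A f f' -> A' `<=` A].
Proof.
move=> A0S f0P.
pose P (p : set T * (T -> T -> T)) :=
  [/\ A0 `<=` p.1, p.1 `<=` S & square_inj p.1 p.2].
pose R (p q : {p | P p}) := `[< (sval p).1 `<=` (sval q).1 /\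
  agree_on_square (sval p).1 (sval p).2 (sval q).2 >].
have P0 : P (A0, f0) by split.
have [||C Ctot|[[A f] [/= A0A AS fP]] Amax] := @ZL_preorder _ (exist _ _ P0) R.
- by move=> p; apply/asboolP; split.
- move=> q p r /asboolP[pq fpq] /asboolP[qr fqr]; apply/asboolP; split.
    exact: subset_trans qr.
  by move=> x y px py; rewrite fpq// fqr//; exact: pq.
- have [[p0 Cp0]|C0] := pselect (exists p, C p); last first.
    by exists (exist _ _ P0) => p Cp; case: C0; exists p.
  pose U := [set x | exists2 p, C p & (sval p).1 x].
  have Cdir p q : C p -> C q -> exists r, [/\ C r, R p r & R q r].
    have Rxx r : R r r by apply/asboolP; split.
    by move=> Cp Cq; have [pq|qp] := Ctot _ _ Cp Cq; [exists q|exists p].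
  have Uex x y : U x -> U y ->
      exists p, [/\ C p, (sval p).1 x & (sval p).1 y].
    move=> [p Cp px] [q Cq qy]; have [r [Cr /asboolP[pr _] /asboolP[qr _]]] := Cdir _ _ Cp Cq.
    by exists r; split=> //; [exact: pr|exact: qr].
  (* The union of a chain is glued pointwise: two members whose domains contain both coordinates
     agree there, being restrictions of a common larger member. Pairs covered by no member get a
     dummy value. *)
  have gex (xy : T * T) : exists z, forall p, C p ->
      (sval p).1 xy.1 -> (sval p).1 xy.2 -> (sval p).2 xy.1 xy.2 = z.
    case: xy => x y /=.
    have [[p [Cp px py]]|np] := pselect (exists p, [/\ C p, (sval p).1 x & (sval p).1 y]).
      exists ((sval p).2 x y) => q Cq qx qy.
      have [r [Cr /asboolP[pr fpr] /asboolP[qr fqr]]] := Cdir _ _ Cp Cq.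
      by rewrite fpr// fqr.
    by exists x => p Cp px py; case: np; exists p.
  have [g gE] := choice gex.
  have PU : P (U, fun x y => g (x, y)).
    split=> /=.
    + by move=> x A0x; exists p0 => //; case: (svalP p0) => + _ _; apply.
    + by move=> x [p _ px]; case: (svalP p) => _ + _; apply.
    + split=> [x y Ux Uy|x y x' y' Ux Uy Ux' Uy'].
        have [p [Cp px py]] := Uex _ _ Ux Uy.
        exists p => //; rewrite -(gE (x, y) p Cp)//=.
        by case: (svalP p) => _ _ [+ _]; apply.
      have [p [Cp px py]] := Uex _ _ Ux Uy.
      have [q [Cq qx qy]] := Uex _ _ Ux' Uy'.
      have [r [Cr /asboolP[pr _] /asboolP[qr _]]] := Cdir _ _ Cp Cq.
      have [rx ry] := (pr _ px, pr _ py); have [rx' ry'] := (qr _ qx, qr _ qy).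
      rewrite -(gE (x, y) r Cr)//= -(gE (x', y') r Cr)//=.
      by case: (svalP r) => _ _ [_]; apply.
  exists (exist _ _ PU) => p Cp; apply/asboolP; split => /=.
    by move=> x px; exists p.
  by move=> x y px py; exact: (gE (x, y) p Cp).
- exists A, f; split=> // A' f' A'S f'P AA' ff'.
  have P' : P (A', f') by split=> //; exact: subset_trans AA'.
  have /asboolP[] : R (exist _ _ P') (exist _ (A, f) (And3 A0A AS fP)).
    by apply: Amax; apply/asboolP; split.
  by [].
Qed.

(* The points of [A `|` g @` A] are coded by [bool * A], so the pairs outside
   [A `*` A] inject into [A] and then, through [g], into [g @` A]. *)
Lemma square_inj_extend (T : Type) (A : set T) (f : T -> T -> T)
    (j : nat -> T) (g : T -> T) :
  injective j -> (forall n, A (j n)) -> square_inj A f ->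
  (forall x, A x -> ~ A (g x)) ->
  (forall x y, A x -> A y -> g x = g y -> x = y) ->
  exists2 f', square_inj (A `|` g @` A) f' & agree_on_square A f f'.
Proof.
move=> jinj Aj [fA finj] gA ginj.
have cex x : exists ba : bool * T, (A `|` g @` A) x ->
    A ba.2 /\ x = if ba.1 then g ba.2 else ba.2.
  have [Ax|nAx] := pselect (A x); first by exists (false, x).
  have [[a Aa <-]|nx] := pselect ((g @` A) x); first by exists (true, a).
  by exists (true, x) => -[].
have [c cE] := choice cex.
(* The two flags are packed in binary into a number from 0 to 3, which [j] turns into a point of
   [A]; two uses of [f] then code everything by one point of [A]. *)
pose e x y := f (f (c x).2 (c y).2) (j ((c x).1 + (c y).1.*2)%N).
have cA x : (A `|` g @` A) x -> A (c x).2 by move=> /cE[].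
have eA x y : (A `|` g @` A) x -> (A `|` g @` A) y -> A (e x y).
  by move=> Ux Uy; apply: (fA) => //; apply: fA; exact: cA.
have einj x y x' y' : (A `|` g @` A) x -> (A `|` g @` A) y ->
    (A `|` g @` A) x' -> (A `|` g @` A) y' -> e x y = e x' y' -> x = x' /\ y = y'.
  move=> Ux Uy Ux' Uy' /finj[]; rewrite ?Aj//; do ?[apply: fA]; do ?[exact: cA].
  move=> /finj[]; do ?[exact: cA]; move=> c2 c2' /jinj c1.
  have [_ xE] := cE _ Ux; have [_ yE] := cE _ Uy.
  have [_ xE'] := cE _ Ux'; have [_ yE'] := cE _ Uy'.
  rewrite xE yE xE' yE' c2 c2'.
  by move: c1; case: (c x).1; case: (c y).1; case: (c x').1; case: (c y').1.
exists (fun x y => if pselect (A x /\ A y) then f x y else g (e x y)).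
  split=> [x y Ux Uy|x y x' y' Ux Uy Ux' Uy'].
    case: pselect => [[Ax Ay]|nxy] /=; first by left; exact: fA.
    by right; exists (e x y) => //; exact: eA.
  case: pselect => [[Ax Ay]|nxy]; case: pselect => [[Ax' Ay']|nxy'] /=.
  - exact: finj.
  - by move=> fg; case: (gA (e x' y')); [exact: eA|rewrite -fg; exact: fA].
  - by move=> fg; case: (gA (e x y)); [exact: eA|rewrite fg; exact: fA].
  - by move=> /ginj => /(_ (eA _ _ Ux Uy) (eA _ _ Ux' Uy')); exact: einj.
by move=> x y Ax Ay; case: pselect => // -[].
Qed.

(* Zorn gives a maximal [A `<=` S] with an injection [A * A -> A].  If
   [A #<= S `\` A], a copy of [A] inside [S `\` A] extends the injection, against
   maximality; so [S `\` A #<= A], and [S] embeds in [A]. *)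
Lemma card_le_square (T : Type) (S : set T) :
  infinite_set S -> S `*` S #<= S.
Proof.
move=> Sinf; have [t0 St0] := infinite_setN0 Sinf.
have [j [jS jinj']] := card_le_funP t0 ((infiniteP S).1 Sinf).
have jinj : injective j by move=> m n; apply: jinj'.
have kex x : exists n, range j x -> x = j n.
  have [[n _ <-]|nx] := pselect (range j x); first by exists n.
  by exists 0%N.
have [k kE] := choice kex.
(* Zorn starts from a countable subset of [S], where [pickle] supplies the pairing. Its image under
   [j] stays inside the maximal [A] and provides tags there. *)
have [||A [f [jA AS [fA finj] Amax]]] := @square_inj_maximal T S (range j)
    (fun x y => j (pickle (k x, k y))).
- by move=> _ [n _ <-]; exact: jS.
- split=> [x y _ _|x y x' y' /kE + /kE + /kE + /kE +]; first by exists (pickle (k x, k y)).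
  by move=> {2}-> {2}-> {2}-> {2}-> /jinj/(pcan_inj pickleK)[-> ->].
have Aj n : A (j n) by apply: jA; exists n.
have [/(card_le_funP t0)[g [gSA ginj]]|/(card_le_funP t0)[g [gA ginj]]] :=
  card_le_total (S `\` A) A; last first.
- exfalso; have [|f' f'P ff'] := @square_inj_extend T A f j g jinj Aj (conj fA finj) _ ginj.
    by move=> x /gA[].
  have US : A `|` g @` A `<=` S by move=> x [/AS//|[a /gA[+ _] <-]].
  have UA := Amax _ f' US f'P (@subsetUl _ _ _) ff'.
  by case: (gA (j 0%N) (Aj _)) => _; apply; apply: UA; right; exists (j 0%N).
(* [S] embeds in [A]: the distinct tags [j 0] and [j 1] separate the points of [A] from those moved
   into [A] by [g]. *)
- pose e x := if pselect (A x) then f x (j 0%N) else f (g x) (j 1%N).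
  have eA x : S x -> A (e x).
    move=> Sx; rewrite /e; case: pselect => [Ax|nAx]; apply: fA => //.
    exact: gSA.
  have einj x y : S x -> S y -> e x = e y -> x = y.
    move=> Sx Sy; rewrite /e; case: pselect => Ax; case: pselect => Ay /finj[] //;
      do ?[exact: gSA]; try by move=> _ /jinj.
    by move=> /ginj ->.
  apply: (@card_le_fun _ _ _ _ (fun xy => f (e xy.1) (e xy.2))).
    by move=> [x y] [/= Sx Sy]; apply/AS/fA; exact: eA.
  move=> [x y] [x' y'] [/= Sx Sy] [/= Sx' Sy'] /finj[]; do ?[exact: eA].
  by move=> /einj-> // /einj->.
Qed.

(** * Products, and the passage to infinite values *)

Lemma card_leX (T U T' U' : Type) (A : set T) (B : set U) (A' : set T')
    (B' : set U') : A #<= A' -> B #<= B' -> A `*` B #<= A' `*` B'.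
Proof.
move=> AA' BB'.
(* The default values [a0] and [b0] below are obtained from a point of the product, so the empty
   product is treated apart. *)
have [/seteqP[A0 _]|/set0P[x0 Ax0]] := eqVneq (A `*` B) set0.
  by rewrite (_ : A `*` B = set0) ?card_ge0//; apply/seteqP.
have [a0] : A' !=set0.
  apply/set0P/eqP => A'0; move: AA'; rewrite A'0 => /card_le0P A0.
  by move: Ax0; rewrite A0 => -[].
have [b0] : B' !=set0.
  apply/set0P/eqP => B'0; move: BB'; rewrite B'0 => /card_le0P B0.
  by move: Ax0; rewrite B0 => -[].
move=> _ _.
have [f [fA finj]] := card_le_funP a0 AA'.
have [g [gB ginj]] := card_le_funP b0 BB'.
apply: (@card_le_fun _ _ _ _ (fun xy => (f xy.1, g xy.2))).
  by move=> [x y] [/= Ax By]; split; [exact: fA|exact: gB].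
move=> [x y] [x' y'] [/= Ax By] [/= Ax' By'] [/finj-> // /ginj-> //].
Qed.

Lemma card_le_infinite (T : Type) (A : set T) : A #<= card_infinite A.
Proof. by apply: (@card_le_fun _ _ _ _ inl) => [x Ax|x y _ _ []//]; left; exists x. Qed.

Lemma card_infinite_infinite (T : Type) (A : set T) :
  infinite_set (card_infinite A).
Proof.
apply/infiniteP; apply: (@card_le_fun _ _ _ _ inr) => [n _|m n _ _ []//].
by right; exists n.
Qed.

(** The disjoint sum of [A] and [nat] embeds in [B]*[B], the first coordinate recording the summand;
    squaring does not enlarge the infinite set [B]. *)
Lemma card_infinite_le (T U : Type) (A : set T) (B : set U) :
  infinite_set B -> A #<= B -> card_infinite A #<= B.
Proof.
move=> Binf AB; apply: card_le_trans (card_le_square Binf).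
have [u0 _] := infinite_setN0 Binf.
have [f [fB finj]] := card_le_funP u0 AB.
have [j [jB jinj]] := card_le_funP u0 ((infiniteP B).1 Binf).
apply: (@card_le_fun _ _ _ _ (fun x => match x with
  inl a => (j 0%N, f a) | inr n => (j 1%N, j n) end)).
  by move=> _ [[a Aa <-]|[n _ <-]]; split=> /=; do ?[exact: jB]; exact: fB.
move=> _ _ [[a Aa <-]|[m _ <-]] [[b Bb <-]|[n _ <-]] [].
- by move=> /finj->.
- by move=> /jinj-/(_ I I).
- by move=> /jinj-/(_ I I).
- by move=> /jinj->.
Qed.

(** * Weight, character and irreducible bases *)

Section cardinal_functions.
Variable X : topologicalType.

Lemma basisP (U : set (set X)) : basis U <->
  U `<=` open /\ forall x A, nbhs x A -> exists B, [/\ U B, B x & B `<=` A].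
Proof.
split=> -[Uo Unbhs]; split=> // x A.
  by move=> /(Unbhs x)[B [UB Bx] BA]; exists B.
by move=> /(Unbhs x)[B [UB Bx BA]]; exists B.
Qed.

Lemma basis_open : basis (@open X).
Proof.
by apply/basisP; split=> // x A; rewrite nbhsE => -[B [oB Bx] BA]; exists B.
Qed.

Lemma basis_card_minP : basis (card_min [set U : set (set X) | basis U]) /\
  forall U : set (set X), basis U -> card_min [set U : set (set X) | basis U] #<= U.
Proof. by apply: card_minP; exists open; exact: basis_open. Qed.

Lemma character_atP (x : X) : nbhd_base x (character_at x) /\
  forall V, nbhd_base x V -> character_at x #<= V.
Proof. by apply: card_minP; exists (nbhs x); split=> // A xA; exists A. Qed.

(** The members of a minimal base that contain [x] form a neighbourhood base of [x]. *)
Lemma character_le_weight : character X #<= weight X.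
Proof.
apply: card_infinite_le (@card_infinite_infinite _ _) _.
apply: card_le_trans (@card_le_infinite _ _).
apply: card_sup_least => x.
set W := card_min _; have [/basisP[Wo Wnbhs] _] := basis_card_minP.
have WxW : [set B | W B /\ B x] `<=` W by move=> B [].
apply: card_le_trans (subset_card_le WxW).
apply: (character_atP x).2; split=> [B [WB Bx]|A /Wnbhs[B [WB Bx BA]]].
  by apply: open_nbhs_nbhs; split=> //; exact: Wo.
by exists B.
Qed.

Lemma weight_le : weight X #<= character X `*` card_infinite [set: X].
Proof.
have Cinf : infinite_set (character X `*` card_infinite [set: X]).
  apply/infiniteP; have /infiniteP nX := @card_infinite_infinite _ [set: X].
  apply: card_le_trans nX _.
  apply: (@card_le_fun _ _ _ _ (fun y => (inr 0%N, y))) => [y Xy|y z _ _ []//].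
  by split=> //; right; exists 0%N.
apply: card_infinite_le Cinf _.
(* The disjoint union of the local bases, each member paired with its point; it maps onto a base by
   taking interiors. *)
pose D := [set xV : X * set X | character_at xV.1 xV.2].
have Dbasis : basis ((fun xV => interior xV.2) @` D).
  apply/basisP; split=> [_ [[x V] _ <-]|x A xA]; first exact: open_interior.
  have [[Vx VA] _] := character_atP x; have [V chV VsubA] := VA _ xA.
  exists (interior V); split; first by exists (x, V).
    exact: Vx.
  exact: subset_trans (@interior_subset _ V) VsubA.
apply: card_le_trans (basis_card_minP.2 _ Dbasis) _.
apply: card_le_trans (card_image_le _ _) _.
apply: (@card_le_trans _ _ _ (card_sup (@character_at X) `*` [set: X])); last first.
  by apply: card_leX; exact: card_le_infinite.
(* Each local base embeds in the common bound [card_sup]; keeping the point as second coordinate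
   makes these embeddings jointly injective. *)
have [g gP] := choice (fun x => card_le_funP set0 (card_sup_ub (@character_at X) x)).
apply: (@card_le_fun _ _ _ _ (fun xV => (g xV.1 xV.2, xV.1))).
  by move=> [x V] /= DxV; split=> //=; exact: (gP x).1.
move=> [x V] [y V'] + + [+ xy] /=; rewrite -{}xy => DV DV'.
by move=> /(gP x).2-> .
Qed.

(** By contraposition: if no [O] works at [x], every neighbourhood of [x] contains a member of some
    [V y] with [y <> x] that contains [x]. Other points keep their own [V z], so the families
    without [V x] would still form a base. *)
Lemma irreducible_base_separating (U : set (set X)) : irreducible_base U ->
  exists (V : X -> set (set X)) (O : X -> set X),
    [/\ forall x, nbhd_base x (V x), forall x B, V x B -> open B,
        forall x, nbhs x (O x) &
        forall x y B, V y B -> B x -> B `<=` O x -> y = x].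
Proof.
move=> [/basisP[Uo _] [V [UV Vbase Virr]]]; exists V.
have Vo x B : V x B -> open B by move=> VB; apply: Uo; rewrite UV; exists x.
suff /choice[O OP] : forall x, exists O, nbhs x O /\
    forall y B, V y B -> B x -> B `<=` O -> y = x.
  by exists O; split=> // x; [exact: (OP x).1|move=> y B; exact: (OP x).2].
move=> x; apply: contrapT => /forallNP noO; apply: (Virr x); apply/basisP.
split=> [B [y _ /Vo]//|z A zA].
have [zx|zx] := pselect (z = x); last first.
  have [Vz VA] := Vbase z; have [B VB BA] := VA _ zA.
  by exists B; split=> //; [exists z|by apply: nbhs_singleton; exact: Vz].
subst z; apply: contrapT => /forallNP nB; apply: (noO A); split=> // y B VB Bx BA.
by apply: contrapT => yx; apply: (nB B); split=> //; exists y.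
Qed.

Lemma card_points_le_square_basis (U W : set (set X)) :
  irreducible_base U -> basis W -> [set: X] #<= W `*` W.
Proof.
move=> /irreducible_base_separating[V [O [Vbase Vo xO VO]]] /basisP[Wo Wnbhs].
have ex x : exists W12 : set X * set X, (W `*` W) W12 /\
    [/\ W12.1 `<=` O x, W12.2 x & exists2 G, V x G & W12.2 `<=` G /\ G `<=` W12.1].
  have [W1 [WW1 W1x W1O]] := Wnbhs _ _ (xO x).
  have [VN VA] := Vbase x.
  have [|G VG GW1] := VA W1; first by apply: open_nbhs_nbhs; split=> //; exact: Wo.
  have [W2 [WW2 W2x W2G]] := Wnbhs _ _ (VN _ VG).
  by exists (W1, W2); split=> //; split=> //; exists G.
have [w wP] := choice ex.
apply: (@card_le_fun _ _ _ _ w) => [x _|x y _ _ wxy]; first exact: (wP x).1.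
(* The set [G] chosen for [x] also fits [y]: it contains [y] because the inner sets coincide, and
   lies in [O y] because the outer ones do. *)
have [_ [w1O _ _]] := wP y; have [_ [_ _ [G VG [w2G Gw1]]]] := wP x.
apply: VO VG _ _; last by apply: subset_trans Gw1 _; rewrite wxy.
by apply: w2G; rewrite wxy; have [_ []] := wP y.
Qed.

End cardinal_functions.

Theorem lemma2p6 (X : topologicalType) :
  (exists U : set (set X), irreducible_base U) ->
  weight X #= character X `*` card_infinite [set: X].
Proof.
move=> [U Uirr]; apply/card_eqPle; split; first exact: weight_le.
have winf := @card_infinite_infinite _ (card_min [set U : set (set X) | basis U]).
(* The identity [w * w = w] serves twice: here to bound the two factors separately by the weight,
   and below to bound the number of points. *)
apply: card_le_trans (card_le_square winf).
apply: card_leX (character_le_weight X) _.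
apply: (card_infinite_le winf).
apply: card_le_trans (card_le_square winf).
apply: card_le_trans (card_points_le_square_basis Uirr (basis_card_minP X).1) _.
by apply: card_leX; exact: card_le_infinite.
Qed.
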